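(* Let $C,D$ be at most countable sets and let $u,v\in\Delta(K\times C\times D)$ be two information structures with conditionally independent information such that $\mathrm{marg}_{K\times D}u=\mathrm{marg}_{K\times D}v$. Then $$d(u,v)=d_1(u,v).$$
   Context: $K$ is a finite set with $|K|\ge2$. An information structure is a probability $u$ on $K\times C\times D$ with $C,D$ at most countable ($k\in K$ is the state, $c\in C$ the signal of player 1, $d\in D$ the signal of player 2). $u$ has conditionally independent information if, under $u$, the signals $c$ and $d$ are conditionally independent given $k$. $\mathrm{marg}$ denotes the marginal distribution. A payoff function is a map $g:K\times I\times J\to[-1,1]$ with $I,J$ nonempty finite sets; $\mathcal{G}$ is the set of all payoff functions. In the zero-sum Bayesian game $\Gamma(u,g)$, $(k,c,d)$ is drawn from $u$, player 1 learns $c$, player 2 learns $d$, they simultaneously choose $i\in I$ and $j\in J$, and player 1 (the maximizer) receives $g(k,i,j)$ from player 2; $\mathrm{val}(u,g)$ is its value in mixed strategies. The value-based distance is $d(u,v)=\sup_{g\in\mathcal{G}}|\mathrm{val}(u,g)-\mathrm{val}(v,g)|$. $\mathcal{G}_1\subset\mathcal{G}$ is the set of single-agent (player 1) problems, i.e. payoff functions $g$ with $g(k,i,j)=g(k,i,j')$ for all $k\in K$, $i\in I$ and $j,j'\in J$, and $d_1(u,v)=\sup_{g\in\mathcal{G}_1}|\mathrm{val}(u,g)-\mathrm{val}(v,g)|$. *)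

(* Defs.v *)
From mathcomp Require Import all_boot all_order all_algebra.
From mathcomp Require Import all_classical all_reals all_analysis.

Set Implicit Arguments.
Unset Strict Implicit.
Unset Printing Implicit Defensive.

Import Order.TTheory GRing.Theory Num.Theory.

Local Open Scope classical_set_scope.
Local Open Scope ring_scope.

(* Sums over the at most countable signal sets are unordered sums of
   nonnegative terms ([esum]); those below are all bounded by 1, so [fine]
   loses nothing. *)

Record info_struct (R : realType) (K : finType) (C D : countType) := InfoStruct {
  info_pmf :> K -> C -> D -> R;
  info_ge0 : forall k c d, 0 <= info_pmf k c d;
  info_sum1 : \esum_(x in [set: K * C * D]) (info_pmf x.1.1 x.1.2 x.2)%:E = 1%E
}.

Section Marginals.
Variables (R : realType) (K : finType) (C D : countType).
Implicit Type u : info_struct R K C D.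

Definition margK u (k : K) : R :=
  fine (\esum_(x in [set: C * D]) (u k x.1 x.2)%:E).

Definition margKC u (k : K) (c : C) : R :=
  fine (\esum_(d in [set: D]) (u k c d)%:E).

Definition margKD u (k : K) (d : D) : R :=
  fine (\esum_(c in [set: C]) (u k c d)%:E).

Definition cond_indep u : Prop :=
  forall k, 0 < margK u k -> forall c d,
    u k c d / margK u k = (margKC u k c / margK u k) * (margKD u k d / margK u k).

End Marginals.

Record mixed (R : realType) (A : finType) := Mixed {
  mixed_pmf :> A -> R;
  mixed_ge0 : forall a, 0 <= mixed_pmf a;
  mixed_sum1 : \sum_(a : A) mixed_pmf a = 1
}.

Section Game.
Variables (R : realType) (K : finType) (C D : countType) (I J : finType).
Variables (u : info_struct R K C D) (g : K -> I -> J -> R).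
Implicit Types (s : C -> mixed R I) (t : D -> mixed R J).

(* Probability that the state is k and the actions played are i and j. *)
Definition outcome_prob s t (k : K) (i : I) (j : J) : R :=
  fine (\esum_(x in [set: C * D]) (u k x.1 x.2 * s x.1 i * t x.2 j)%:E).

Definition expected_payoff s t : R :=
  \sum_(k : K) \sum_(i : I) \sum_(j : J) g k i j * outcome_prob s t k i j.

Definition maxmin : R :=
  sup (range (fun s => inf (range (fun t => expected_payoff s t)))).

Definition minmax : R :=
  inf (range (fun t => sup (range (fun s => expected_payoff s t)))).

Definition is_value (x : R) : Prop := maxmin = x /\ minmax = x.

(* The default 0 is never used when I and J are nonempty and g is bounded:
   the game then has a value, by the minimax theorem. *)
Definition game_value : R := xget 0 [set x | is_value x].

End Game.

Section Distances.
Variables (R : realType) (K : finType).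

Definition payoff_fun (I J : finType) (g : K -> I -> J -> R) : Prop :=
  [/\ (0 < #|I|)%N, (0 < #|J|)%N & forall k i j, -1 <= g k i j <= 1].

Definition single_agent (I J : finType) (g : K -> I -> J -> R) : Prop :=
  forall k i j j', g k i j = g k i j'.

Variables (C D : countType).
Implicit Types u v : info_struct R K C D.

Definition vdist u v : R :=
  sup [set x | exists (I J : finType) (g : K -> I -> J -> R),
    payoff_fun g /\ x = `|game_value u g - game_value v g|].

Definition vdist1 u v : R :=
  sup [set x | exists (I J : finType) (g : K -> I -> J -> R),
    [/\ payoff_fun g, single_agent g & x = `|game_value u g - game_value v g|]].

End Distances.

(* Main.v *)
Require Import Defs.
From mathcomp Require Import all_boot all_order all_algebra.
From mathcomp Require Import all_classical all_reals all_analysis.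
From mathcomp Require Import ring lra.

(** Conditional independence lets the payoff of a pair of strategies factor
    through two finite arrays: the probabilities A(k,i) that the state is k and
    player 1 plays i, and the conditional probabilities B(k,j) that player 2
    plays j in state k.  The payoff is then the sum of g(k,i,j) A(k,i) B(k,j)
    ([expected_payoff_factor]), and B depends on the structure only through the
    marginal on states and signals of player 2 ([condD_eq]).  Hence a strategy
    of player 2 induces the same B under u and under v.

    Fix a strategy t of player 2 that is optimal up to e in the game (u, g), and
    let G(k,i) be the sum over j of g(k,i,j) B(k,j).  This is a single-agent
    payoff function, and its value under u (respectively v) is what player 1 can
    get at best against t in (u, g) (respectively (v, g)):
    [freeze_reply_value].  Therefore val(u,G) is at most val(u,g) + e, while
    val(v,G) is at least val(v,g), as t need not be optimal in (v, g).  Thus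
    val(v,g) - val(u,g) is at most val(v,G) - val(u,G) + e
    ([single_agent_gap]); exchanging u and v gives d <= d_1, and d_1 <= d is
    the inclusion of the single-agent problems in all problems.

    The argument reads the value as the best that player 2 can guarantee, so it
    needs the existence of the value although the signal sets are infinite.
    Since the payoff is a bilinear form in the bounded finite arrays A and B,
    a minimax theorem for bilinear forms on convex bounded subsets of a
    finite-dimensional space is enough ([bilinear_minimax]).  Approximation
    stands in for compactness: the arrays of player 2 are replaced by a finite
    net, and against finitely many replies an approximate maximizer is found by
    minimizing the squared distance to the nonnegative orthant ([orthant_approach]). *)

Set Implicit Arguments.
Unset Strict Implicit.
Unset Printing Implicit Defensive.

Import Order.TTheory GRing.Theory Num.Theory.

Local Open Scope classical_set_scope.
Local Open Scope ring_scope.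

(** * A minimax theorem for bilinear payoffs *)

(** The negative part of a mixture is at most
    |(1 - l) n - l b| with n the negative part of a; squaring gives the bound,
    in which the cross term carries the sign needed below. *)
Lemma sqr_neg_part_mix (R : realType) (l a b : R) : 0 <= l -> l <= 1 ->
  (Num.max 0 (- ((1 - l) * a + l * b))) ^+ 2 <=
  (1 - l) ^+ 2 * (Num.max 0 (- a)) ^+ 2
    - 2 * l * (1 - l) * (Num.max 0 (- a) * b) + l ^+ 2 * b ^+ 2.
Proof.
move=> l0 l1; set z := (1 - l) * a + l * b; set n := Num.max 0 (- a).
have -> : (1 - l) ^+ 2 * n ^+ 2 - 2 * l * (1 - l) * (n * b) + l ^+ 2 * b ^+ 2
  = ((1 - l) * n - l * b) ^+ 2 by ring.
have an : - a <= n by rewrite le_max lexx orbT.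
have zn : - z <= (1 - l) * n - l * b by rewrite /z; nra.
case: (lerP 0 (- z)) => z0; last by rewrite expr0n sqr_ge0.
by rewrite ler_sqr ?nnegrE //; lra.
Qed.

(** Let phi(s) be the squared distance from the vector f(s) to the nonnegative
    orthant, that is the sum of the squared negative parts.  Given s, weight the
    coordinates by their negative parts: the hypothesis on mixed p provides s'
    with a nonnegative weighted sum.  A small step from s towards s' then lowers
    phi at first order by 2 l phi(s), at a second-order cost of l^2 C.  So the
    infimum of phi cannot be positive. *)
Lemma orthant_approach (R : realType) (S : Type) (Q : finType)
    (f : S -> Q -> R) (M e : R) (s0 : S) :
  (forall s q, `|f s q| <= M) ->
  (forall s s' l, 0 <= l <= 1 ->
     exists s'', forall q, f s'' q = (1 - l) * f s q + l * f s' q) ->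
  (forall p : mixed R Q, exists s, 0 <= \sum_q p q * f s q) ->
  0 < e -> exists s, forall q, - e <= f s q.
Proof.
move=> fM fconv fpos e0; apply: contrapT => nos.
pose phi s : R := \sum_q (Num.max 0 (- f s q)) ^+ 2.
have phi_ge s : e ^+ 2 <= phi s.
  have /existsNP[q /negP] : ~ forall q, - e <= f s q.
    by move=> h; apply: nos; exists s.
  rewrite -ltNge => fq; rewrite /phi (bigD1 q) //=.
  rewrite -[leLHS]addr0; apply: lerD; last first.
    by apply: sumr_ge0 => i _; rewrite sqr_ge0.
  by rewrite ler_sqr ?nnegrE ?le_max ?lexx ?(ltW e0) //; lra.
have dom (s : S) : exists s', 0 <= \sum_q Num.max 0 (- f s q) * f s' q.
  have ge0 q : 0 <= Num.max 0 (- f s q) by rewrite le_max lexx.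
  pose W := \sum_q Num.max 0 (- f s q).
  have W0 : 0 <= W by apply: sumr_ge0.
  case: (eqVneq W 0) => [WE|Wn].
    exists s; rewrite big1 // => q _; suff -> : Num.max 0 (- f s q) = 0.
      by rewrite mul0r.
    by have /psumr_eq0P := WE; apply.
  have Wp : 0 < W by rewrite lt_neqAle eq_sym Wn.
  have p0 q : 0 <= Num.max 0 (- f s q) / W by rewrite divr_ge0.
  have p1 : \sum_q Num.max 0 (- f s q) / W = 1.
    by rewrite -mulr_suml divff.
  have [s' hs'] := fpos (Mixed p0 p1); exists s'.
  have -> : \sum_q Num.max 0 (- f s q) * f s' q
    = W * \sum_q Num.max 0 (- f s q) / W * f s' q.
    by rewrite mulr_sumr; apply: eq_bigr => q _; field.
  by rewrite mulr_ge0.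
(* C bounds both phi and the squared length of every vector f s. *)
pose C := \sum_(q : Q) M ^+ 2.
have fC s : \sum_q (f s q) ^+ 2 <= C.
  apply: ler_sum => q _; rewrite -real_normK ?num_real //.
  by rewrite ler_sqr ?nnegrE //; exact: le_trans (fM s q).
have phiC s : phi s <= C.
  apply: le_trans (fC s); apply: ler_sum => q _.
  case: (lerP 0 (- f s q)) => h; last by rewrite expr0n sqr_ge0.
  by rewrite sqrrN.
pose d := inf (range phi).
have lb : has_lbound (range phi) by exists (e ^+ 2) => _ [s _ <-].
have dphi s : d <= phi s by apply: ge_inf => //; exists s.
have d0 : 0 < d.
  apply: lt_le_trans (_ : e ^+ 2 <= d); first by rewrite exprn_gt0.
  by apply: lb_le_inf => [|_ [s _ <-]//]; exists (phi s0), s0.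
have C0 : 0 < C := lt_le_trans d0 (le_trans (dphi s0) (phiC s0)).
have dC : d <= C := le_trans (dphi s0) (phiC s0).
(* The step d / (2 C) makes the second-order terms cost l d in all, against a
   first-order gain of 2 l d. *)
pose l : R := d / (2 * C).
have lC : l * C = d / 2 by rewrite /l; field; rewrite gt_eqF.
have l0 : 0 < l by rewrite divr_gt0 // mulr_gt0.
have l1 : l <= 1 by rewrite ler_pdivrMr ?mulr_gt0 //; lra.
have [_ [s _ <-] sd] : exists2 x, range phi x & x < d + l * d / 2.
  apply: inf_adherent; last by split => //; exists (phi s0), s0.
  by rewrite divr_gt0 // mulr_gt0.
have [s' hs'] := dom s.
have [|s'' hs''] := fconv s s' l; first by rewrite (ltW l0).
suff : phi s'' < d by rewrite ltNge dphi.
have : phi s'' <= (1 - l) ^+ 2 * phi s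
    - 2 * l * (1 - l) * (\sum_q Num.max 0 (- f s q) * f s' q)
    + l ^+ 2 * \sum_q (f s' q) ^+ 2.
  rewrite !mulr_sumr -sumrB -big_split /=; apply: ler_sum => q _.
  by rewrite hs''; apply: sqr_neg_part_mix => //; exact: ltW.
have := fC s'; have := phiC s; have := dphi s; move: hs' sd.
move: (phi s) (phi s'') (\sum_q _ * _) (\sum_q _ ^+ 2) => x y z w z0 xd dx xC wC yE.
have h1 : 0 <= l * (1 - l) * z 
  by apply: mulr_ge0 => //; apply: mulr_ge0; [exact: ltW|rewrite subr_ge0].
have h2 : l ^+ 2 * w <= l * (d / 2).
  by rewrite -lC expr2 -mulrA !ler_pM2l.
have h3 : l ^+ 2 * x <= l * (d / 2).
  by rewrite -lC expr2 -mulrA !ler_pM2l.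
have h4 : l * d <= l * x by rewrite ler_pM2l.
have h5 : 0 < l * d by rewrite mulr_gt0.
have yE' : y <= x - 2 * (l * x) + l ^+ 2 * x - 2 * (l * (1 - l) * z) + l ^+ 2 * w.
  by apply: le_trans yE _; rewrite le_eqVlt; apply/orP; left; apply/eqP; ring.
lra.
Qed.

(** The grid of mesh 1/(N+1) cuts the cube into finitely many cells; the net
    picks one point of the family in each cell that it meets. *)
Lemma finite_net (R : realType) (T : Type) (L : finType) (b : T -> L -> R)
    (e : R) (t0 : T) :
  (forall t l, 0 <= b t l <= 1) -> 0 < e ->
  exists (Q : finType) (rep : Q -> T), forall t, exists q, forall l,
    `|b t l - b (rep q) l| <= e.
Proof.
move=> b01 e0.
have [N] := ltr_add_invr e0; rewrite add0r => Ne.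
pose cell t : {ffun L -> 'I_N.+2} := [ffun l => inord (Num.truncn (N.+1%:R * b t l))].
pose rep q := if pselect (exists t, cell t = q) is left h
  then projT1 (cid h) else t0.
exists {ffun L -> 'I_N.+2}, rep => t; exists (cell t) => l.
have cellP t' : (cell t' l)%:R <= N.+1%:R * b t' l < (cell t' l).+1%:R.
  have /andP[bt0 bt1] := b01 t' l.
  have h0 : 0 <= N.+1%:R * b t' l by rewrite mulr_ge0.
  rewrite ffunE inordK ?truncn_itv // ltnS -(ler_nat R).
  apply: le_trans (_ : N.+1%:R * b t' l <= _); first by rewrite truncn_le.
  by rewrite ler_piMr.
have : cell (rep (cell t)) = cell t.
  rewrite /rep; case: pselect => [h|[]]; last by exists t.
  by case: (cid h).
move=> ce; have := cellP (rep (cell t)); have := cellP t; rewrite ce.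
move: (cell t l) (b (rep _) l) (b t l) => c y x /andP[h1 h2] /andP[h3 h4].
apply: le_trans (ltW Ne).
rewrite -(ler_pM2l (_ : 0 < N.+1%:R)) // divff // -[X in X * _]ger0_norm //.
by rewrite -normrM mulrBr ler_norml; rewrite -natr1 in h2 h4; apply/andP; split; lra.
Qed.

Lemma binary_mixed_sum1 (R : realType) (l : R) :
  \sum_(h : bool) (if h then l else 1 - l) = 1.
Proof. by rewrite big_bool /= addrC subrK. Qed.

Lemma binary_mixed_ge0 (R : realType) (l : R) (h : bool) :
  0 <= l <= 1 -> 0 <= (if h then l else 1 - l).
Proof. by case/andP => l0 l1; case: h => //; rewrite subr_ge0. Qed.

Definition binary_mixed (R : realType) (l : R) (l01 : 0 <= l <= 1) :
  mixed R bool := Mixed (fun h => binary_mixed_ge0 h l01) (binary_mixed_sum1 l).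

(** The error budget in the minimax theorem: 1/4 for the approximate
    maximizer, 1/4 for the shift of the threshold, 1/2 for the net. *)
Lemma net_slack (R : realFieldType) (x y v e : R) :
  - (e / 4) <= y - v + e / 4 -> y - x <= e / 2 -> v - e <= x.
Proof. by move=> h1 h2; lra. Qed.

(** Convexity of the two families is asked in the form in which strategies
    provide it: every finite mixture of members is realized by a member.
    Only max-min >= min-max needs an argument.  A finite net of the family b
    turns the right-hand player's choice into a finite one, at a cost of
    e/2; mixtures over the net are themselves members, so each of them leaves
    the left-hand player at least the min-max up to e/4, which is the hypothesis
    of [orthant_approach]. *)
Lemma bilinear_minimax (R : realType) (S T : Type) (L : finType)
    (a : S -> L -> R) (b : T -> L -> R) (M : R) (s0 : S) (t0 : T) :
  (forall s l, `|a s l| <= M) ->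
  (forall t l, 0 <= b t l <= 1) ->
  (forall (Q : finType) (p : mixed R Q) (s : Q -> S),
     exists s', forall i, a s' i = \sum_q p q * a (s q) i) ->
  (forall (Q : finType) (p : mixed R Q) (t : Q -> T),
     exists t', forall i, b t' i = \sum_q p q * b (t q) i) ->
  sup (range (fun s => inf (range (fun t => \sum_i a s i * b t i)))) =
  inf (range (fun t => sup (range (fun s => \sum_i a s i * b t i)))).
Proof.
move=> aM b01 aconv bconv.
pose F s t := \sum_i a s i * b t i.
pose B := \sum_(i : L) M.
have M0 (i : L) : 0 <= M := le_trans (normr_ge0 _) (aM s0 i).
have FB s t : `|F s t| <= B.
  apply: le_trans (ler_norm_sum _ _ _) _; apply: ler_sum => i _.
  rewrite normrM -[M]mulr1; apply: ler_pM => //.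
  by have /andP[h1 h2] := b01 t i; rewrite ger0_norm.
have FBu s t : F s t <= B by apply: le_trans (ler_norm _) (FB s t).
have FBl s t : - B <= F s t by have := FB s t; rewrite ler_norml => /andP[].
have lbF s : has_lbound (range (F s)) by exists (- B) => _ [t _ <-].
have ubF t : has_ubound (range (F ^~ t)) by exists B => _ [s _ <-].
have infF s t : inf (range (F s)) <= F s t by apply: ge_inf => //; exists t.
have supF s t : F s t <= sup (range (F ^~ t)) by apply: ub_le_sup => //; exists s.
have ubI : has_ubound (range (fun s => inf (range (F s)))).
  by exists B => _ [s _ <-]; apply: le_trans (infF s t0) _.
have lbS : has_lbound (range (fun t => sup (range (F ^~ t)))).
  by exists (- B) => _ [t _ <-]; apply: le_trans (supF s0 t).
apply/eqP; rewrite eq_le; apply/andP; split.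
  apply: ge_sup; first by exists (inf (range (F s0))), s0.
  move=> _ [s _ <-]; apply: lb_le_inf; first by exists (sup (range (F ^~ t0))), t0.
  by move=> _ [t _ <-]; apply: le_trans (infF s t) _.
set v := inf _; apply/ler_addgt0Pr => e e0.
have B0 : 0 <= B by apply: sumr_ge0 => i _; exact: M0.
have n0 : 0 < e / 2 / (B + 1) by rewrite !divr_gt0 // ltr_wpDl.
have [Q [rep net]] := finite_net t0 b01 n0.
pose f s q := F s (rep q) - v + e / 4.
have [s hs] : exists s, forall q, - (e / 4) <= f s q.
  apply: (@orthant_approach _ _ _ f (B + `|v| + e / 4)) => // [s q|s s' l l01|p|].
  - apply: le_trans (ler_normD _ _) _; rewrite [`|e / 4|]ger0_norm; last exact/ltW/divr_gt0.
    by rewrite lerD2r; apply: le_trans (ler_normB _ _) _; rewrite lerD2r.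
  - have [s'' hs''] := aconv _ (binary_mixed l01) (fun h => if h then s' else s).
    exists s'' => q.
    have -> : f s'' q = (1 - l) * F s (rep q) + l * F s' (rep q) - v + e / 4.
      rewrite /f; congr (_ - _ + _); rewrite /F !mulr_sumr -big_split /=.
      by apply: eq_bigr => i _; rewrite hs'' big_bool /=; ring.
    by rewrite /f; ring.
  - have [t ht] := bconv Q p rep.
    have hv : v <= sup (range (F ^~ t)) by apply: ge_inf => //; exists t.
    have [_ [s _ <-] hs] : exists2 x, range (F ^~ t) x & v - e / 4 < x.
      have [||x hx hx'] := @sup_adherent R (range (F ^~ t)) (e / 4).
      + by rewrite divr_gt0.
      + by split => //; exists (F s0 t), s0.
      by exists x => //; apply: le_lt_trans hx'; rewrite lerD2r.
    exists s; have -> : \sum_q p q * f s q = F s t - v + e / 4.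
      have -> : F s t = \sum_q p q * F s (rep q).
        rewrite /F; under eq_bigr do rewrite ht mulr_sumr.
        rewrite exchange_big /=; apply: eq_bigr => q _; rewrite mulr_sumr.
        by apply: eq_bigr => i _; ring.
      rewrite -addrA; under eq_bigr do rewrite /f -addrA.
      move: (- v + e / 4) => w; rewrite -[w in RHS]mul1r -(mixed_sum1 p).
      by rewrite mulr_suml -big_split /=; apply: eq_bigr => q _; rewrite mulrDr.
    by move: hs; rewrite ltrBlDr => /ltW h; rewrite addrAC subr_ge0.
  - by rewrite divr_gt0.
apply: le_trans (_ : inf (range (F s)) + e <= _); last first.
  by rewrite lerD2r; apply: ub_le_sup => //; exists s.
rewrite -lerBlDr; apply: lb_le_inf; first by exists (F s t0), t0.
move=> _ [t _ <-]; have [q hq] := net t.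
apply: net_slack (hs q) _.
  rewrite /F -sumrB.
  apply: le_trans (_ : \sum_(i : L) M * (e / 2 / (B + 1)) <= _).
    apply: ler_sum => i _; rewrite -mulrBr; apply: le_trans (ler_norm _) _.
    by rewrite normrM distrC; apply: ler_pM.
  rewrite -mulr_suml -/B mulrA ler_pdivrMr ?ltr_wpDl //.
  by rewrite [leLHS]mulrC ler_pM2l ?divr_gt0 // lerDl.
Qed.

(** * Real-valued sums of nonnegative families *)

Definition wsum (R : realType) (T : choiceType) (w : T -> R) : R :=
  fine (\esum_(x in [set: T]) (w x)%:E).

Definition ge0_summable (R : realType) (T : choiceType) (w : T -> R) : Prop :=
  (forall x, 0 <= w x) /\ (\esum_(x in [set: T]) (w x)%:E < +oo)%E.

Lemma wsumE (R : realType) (T : choiceType) (w : T -> R) :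
  ge0_summable w -> (\esum_(x in [set: T]) (w x)%:E = (wsum w)%:E)%E.
Proof.
move=> [w0 woo]; rewrite fineK // ge0_fin_numE //.
by apply: esum_ge0 => x _; rewrite lee_fin.
Qed.

Lemma ge0_summable_fin (R : realType) (T : choiceType) (w : T -> R) (r : R) :
  (forall x, 0 <= w x) -> (\esum_(x in [set: T]) (w x)%:E = r%:E)%E ->
  ge0_summable w /\ wsum w = r.
Proof. by move=> w0 wr; rewrite /ge0_summable /wsum wr /= ltry. Qed.

Lemma ge0_summable_le (R : realType) (T : choiceType) (w w' : T -> R) :
  ge0_summable w -> (forall x, 0 <= w' x <= w x) -> ge0_summable w'.
Proof.
move=> [w0 woo] h; split=> [x|]; first by have /andP[] := h x.
by apply: le_lt_trans woo; apply: le_esum => x _; have /andP[] := h x.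
Qed.

Lemma wsum_ge0 (R : realType) (T : choiceType) (w : T -> R) :
  (forall x, 0 <= w x) -> 0 <= wsum w.
Proof. by move=> w0; apply/fine_ge0/esum_ge0 => x _; rewrite lee_fin. Qed.

Lemma esum_ge_term (R : realType) (T : choiceType) (a : T -> \bar R) (x : T) :
  (forall x, (0 <= a x)%E) -> (a x <= \esum_(x in [set: T]) a x)%E.
Proof.
move=> a0; rewrite (esumID [set x])// setTI esum_set1 //.
by rewrite leeDl //; apply: esum_ge0.
Qed.

Lemma wsum_ge_term (R : realType) (T : choiceType) (w : T -> R) (x : T) :
  ge0_summable w -> w x <= wsum w.
Proof.
move=> sw; rewrite -lee_fin -wsumE //; apply: (esum_ge_term (a := EFin \o w)).
by move=> y; rewrite lee_fin; case: sw.
Qed.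

Lemma le_esumZl (R : realType) (T : choiceType) (c : R) (w : T -> R) :
  0 <= c -> (forall x, 0 <= w x) ->
  (\esum_(x in [set: T]) (c * w x)%:E
    <= c%:E * \esum_(x in [set: T]) (w x)%:E)%E.
Proof.
move=> c0 w0; apply: ge_ereal_sup => _ [X XS <-].
under eq_fsbigr do rewrite EFinM.
rewrite -ge0_mule_fsumr; last by move=> x; rewrite lee_fin.
by apply: lee_wpmul2l; rewrite ?lee_fin //; apply: ereal_sup_ubound; exists X.
Qed.

(** The inequality [le_esumZl], applied to c and to its inverse, gives both
    bounds. *)
Lemma wsumZl (R : realType) (T : choiceType) (c : R) (w : T -> R) :
  0 <= c -> ge0_summable w ->
  ge0_summable (fun x => c * w x) /\ wsum (fun x => c * w x) = c * wsum w.
Proof.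
move=> c0 sw; have [w0 _] := sw.
have cw0 x : 0 <= c * w x by rewrite mulr_ge0.
apply: ge0_summable_fin => //; rewrite EFinM -wsumE //.
apply/eqP; rewrite eq_le le_esumZl //=.
case: (eqVneq c 0) => [->|cn]; first by rewrite mul0e; apply: esum_ge0 => x _; rewrite mul0r.
have -> : \esum_(x in [set: T]) (w x)%:E = \esum_(x in [set: T]) (c^-1 * (c * w x))%:E.
  by apply: eq_esum => x _; rewrite mulKf.
have ci : 0 <= c^-1 by rewrite invr_ge0.
apply: le_trans (_ : c%:E * (c^-1%:E * \esum_(x in [set: T]) (c * w x)%:E) <= _)%E.
  by apply: lee_wpmul2l; rewrite ?lee_fin //; apply: le_esumZl.
by rewrite muleA -EFinM divff // mul1e.
Qed.

Lemma wsum_sum (R : realType) (T : choiceType) (Q : finType) (w : Q -> T -> R) :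
  (forall q, ge0_summable (w q)) ->
  wsum (fun x => \sum_q w q x) = \sum_q wsum (w q).
Proof.
move=> sw; have w0 q x : 0 <= w q x by case: (sw q).
have E : (\esum_(x in [set: T]) (\sum_q w q x)%:E = (\sum_q wsum (w q))%:E)%E.
  under eq_esum do rewrite -sumEFin.
  rewrite esum_sum => [|x q _ _]; last by rewrite lee_fin.
  by rewrite -sumEFin; apply: eq_bigr => q _; rewrite wsumE.
by case: (ge0_summable_fin _ E) => // x; apply: sumr_ge0.
Qed.

Lemma esum_pair (R : realType) (C D : choiceType) (w : C -> D -> R) :
  (forall c d, 0 <= w c d) ->
  (\esum_(c in [set: C]) \esum_(d in [set: D]) (w c d)%:E
   = \esum_(x in [set: C * D]) (w x.1 x.2)%:E)%E.
Proof.
move=> w0; rewrite (esum_esum (a := fun c d => (w c d)%:E)) //.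
  by congr (esum _ _); apply/seteqP; split.
by move=> c d _ _; rewrite lee_fin.
Qed.

Lemma wsum_fubini (R : realType) (C D : choiceType) (w : C -> D -> R) :
  ge0_summable (fun x : C * D => w x.1 x.2) ->
  ge0_summable (fun c => wsum (w c)) /\
  wsum (fun c => wsum (w c)) = wsum (fun x : C * D => w x.1 x.2).
Proof.
move=> sw; have w0 c d : 0 <= w c d by case: sw => /(_ (c, d)).
have swc c : ge0_summable (w c).
  split=> //; apply: le_lt_trans sw.2; rewrite -esum_pair //.
  apply: (esum_ge_term (a := fun c => \esum_(d in [set: D]) (w c d)%:E)).
  by move=> c'; apply: esum_ge0 => d _; rewrite lee_fin.
apply: ge0_summable_fin => [c|]; first exact: wsum_ge0.
by under eq_esum do rewrite -wsumE //; rewrite esum_pair // wsumE.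
Qed.

Lemma wsum_fubini_swap (R : realType) (C D : choiceType) (w : C -> D -> R) :
  ge0_summable (fun x : C * D => w x.1 x.2) ->
  ge0_summable (fun d => wsum (w ^~ d)) /\
  wsum (fun d => wsum (w ^~ d)) = wsum (fun x : C * D => w x.1 x.2).
Proof.
have E : (\esum_(x in [set: C * D]) (w x.1 x.2)%:E
        = \esum_(x in [set: D * C]) (w x.2 x.1)%:E)%E.
  apply: (reindex_esum _ _ (fun x : D * C => (x.2, x.1))); split => //.
  - by move=> [d1 c1] [d2 c2] _ _ /= [-> ->].
  - by move=> [c d] _; exists (d, c).
move=> sw; have sw' : ge0_summable (fun x : D * C => w x.2 x.1).
  by split=> [[d c]|]; [case: sw => /(_ (c, d))|rewrite -E; case: sw].
have -> : wsum (fun x : C * D => w x.1 x.2) = wsum (fun x : D * C => w x.2 x.1).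
  by rewrite /wsum E.
by apply: (wsum_fubini (w := fun d c => w c d)).
Qed.

Lemma wsum_prod (R : realType) (C D : choiceType) (a : C -> R) (b : D -> R) :
  ge0_summable a -> ge0_summable b ->
  wsum (fun x : C * D => a x.1 * b x.2) = wsum a * wsum b.
Proof.
move=> sa sb; have [a0 _] := sa; have [b0 _] := sb.
have E : (\esum_(x in [set: C * D]) (a x.1 * b x.2)%:E = (wsum a * wsum b)%:E)%E.
  rewrite -(esum_pair (w := fun c d => a c * b d)); last first.
    by move=> c d; rewrite mulr_ge0.
  transitivity (\esum_(c in [set: C]) (wsum b * a c)%:E)%E.
    apply: eq_esum => c _; have [s1 s2] := wsumZl (a0 c) sb.
    by rewrite wsumE // s2 mulrC.
  have [s1 s2] := wsumZl (wsum_ge0 b0) sa.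
  by rewrite wsumE // s2 mulrC.
by case: (ge0_summable_fin _ E) => // x; rewrite mulr_ge0.
Qed.

(** * Mixed actions and the arrays induced by strategies *)

Lemma mixed_le1 (R : realType) (A : finType) (p : mixed R A) (a : A) : p a <= 1.
Proof.
rewrite -(mixed_sum1 p) (bigD1 a) //= lerDl; apply: sumr_ge0 => b _.
exact: mixed_ge0.
Qed.

Lemma pure_ge0 (R : realType) (A : finType) (a b : A) : 0 <= (b == a)%:R :> R.
Proof. by []. Qed.

Lemma pure_sum1 (R : realType) (A : finType) (a : A) :
  \sum_(b : A) (b == a)%:R = 1 :> R.
Proof. by rewrite (bigD1 a) //= eqxx big1 ?addr0 // => b /negbTE ->. Qed.

Definition pure (R : realType) (A : finType) (a : A) : mixed R A :=
  Mixed (@pure_ge0 R A a) (@pure_sum1 R A a).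

Lemma mixture_ge0 (R : realType) (Q A : finType) (p : mixed R Q)
    (s : Q -> mixed R A) (a : A) : 0 <= \sum_q p q * s q a.
Proof. by apply: sumr_ge0 => q _; rewrite mulr_ge0 ?mixed_ge0. Qed.

Lemma mixture_sum1 (R : realType) (Q A : finType) (p : mixed R Q)
    (s : Q -> mixed R A) : \sum_a \sum_q p q * s q a = 1.
Proof.
rewrite exchange_big /= -(mixed_sum1 p); apply: eq_bigr => q _.
by rewrite -mulr_sumr mixed_sum1 mulr1.
Qed.

Definition mixture (R : realType) (Q A : finType) (p : mixed R Q)
    (s : Q -> mixed R A) : mixed R A :=
  Mixed (mixture_ge0 p s) (mixture_sum1 p s).

(** With w the joint weights of a state k and the signal c, this is the
    probability that the state is k and the action a is played; with w the
    conditional law of the signal, it is the conditional probability of a. *)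
Definition induced (R : realType) (C : countType) (A : finType) (w : C -> R)
    (s : C -> mixed R A) (a : A) : R :=
  wsum (fun c => w c * s c a).

Lemma induced_summable (R : realType) (C : countType) (A : finType) (w : C -> R)
    (s : C -> mixed R A) (a : A) :
  ge0_summable w -> ge0_summable (fun c => w c * s c a).
Proof.
move=> sw; have [w0 _] := sw; apply: (ge0_summable_le sw) => c.
by rewrite mulr_ge0 ?mixed_ge0 //= ler_piMr ?mixed_le1.
Qed.

Lemma induced_ge0 (R : realType) (C : countType) (A : finType) (w : C -> R)
    (s : C -> mixed R A) (a : A) : ge0_summable w -> 0 <= induced w s a.
Proof. by move=> [w0 _]; apply: wsum_ge0 => c; rewrite mulr_ge0 ?mixed_ge0. Qed.

Lemma induced_sum (R : realType) (C : countType) (A : finType) (w : C -> R)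
    (s : C -> mixed R A) :
  ge0_summable w -> \sum_a induced w s a = wsum w.
Proof.
move=> sw; rewrite -wsum_sum; last by move=> a; apply: induced_summable.
by congr wsum; apply/funext => c; rewrite -mulr_sumr mixed_sum1 mulr1.
Qed.

Lemma induced_mixture (R : realType) (C : countType) (Q A : finType)
    (w : C -> R) (p : mixed R Q) (s : Q -> C -> mixed R A) (a : A) :
  ge0_summable w ->
  induced w (fun c => mixture p (s ^~ c)) a = \sum_q p q * induced w (s q) a.
Proof.
move=> sw.
have sq q : ge0_summable (fun c => w c * s q c a) by apply: induced_summable.
have Z q := wsumZl (mixed_ge0 p q) (sq q).
under eq_bigr do rewrite -(Z _).2.
rewrite -wsum_sum => [|q]; last exact: (Z q).1.
congr wsum; apply/funext => c /=; rewrite mulr_sumr.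
by apply: eq_bigr => q _; rewrite mulrCA.
Qed.

(** * Factorization under conditional independence *)

(** The slice at state k is the image of an injection into K x C x D, so its
    sum is at most the total mass 1. *)
Lemma state_summable (R : realType) (K : finType) (C D : countType)
    (u : info_struct R K C D) (k : K) :
  ge0_summable (fun x : C * D => u k x.1 x.2) /\ margK u k <= 1.
Proof.
have le1 : (\esum_(x in [set: C * D]) (u k x.1 x.2)%:E <= 1%:E)%E.
  rewrite -(info_sum1 u).
  rewrite -(esum_image [set: C * D] (fun x : C * D => (k, x.1, x.2))
    (fun y : K * C * D => (u y.1.1 y.1.2 y.2)%:E)); last first.
    by move=> [c d] [c' d'] _ _ [-> ->].
  rewrite esum_mkcond; apply: le_esum => y _.
  by case: ifP => // _; rewrite lee_fin info_ge0.
have s : ge0_summable (fun x : C * D => u k x.1 x.2).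
  split=> [x|]; first exact: info_ge0.
  by apply: le_lt_trans le1 _; rewrite ltry.
by split=> //; rewrite -lee_fin; move: le1; rewrite wsumE.
Qed.

Lemma margK_ge0 (R : realType) (K : finType) (C D : countType)
    (u : info_struct R K C D) (k : K) : 0 <= margK u k.
Proof. by apply: wsum_ge0 => x; apply: info_ge0. Qed.

Lemma margKC_sum (R : realType) (K : finType) (C D : countType)
    (u : info_struct R K C D) (k : K) :
  ge0_summable (margKC u k) /\ wsum (margKC u k) = margK u k.
Proof. exact: wsum_fubini (state_summable u k).1. Qed.

Lemma margKD_sum (R : realType) (K : finType) (C D : countType)
    (u : info_struct R K C D) (k : K) :
  ge0_summable (margKD u k) /\ wsum (margKD u k) = margK u k.
Proof. exact: wsum_fubini_swap (state_summable u k).1. Qed.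

(** The law of player 2's signal given k.  It vanishes identically in a state
    of probability 0, as the inverse of 0 is 0. *)
Definition condD (R : realType) (K : finType) (C D : countType)
    (u : info_struct R K C D) (k : K) (d : D) : R :=
  (margK u k)^-1 * margKD u k d.

Lemma condD_sum (R : realType) (K : finType) (C D : countType)
    (u : info_struct R K C D) (k : K) :
  ge0_summable (condD u k) /\ wsum (condD u k) = (margK u k)^-1 * margK u k.
Proof.
have [sD eD] := margKD_sum u k; rewrite -[X in _ = _ * X]eD.
by apply: wsumZl => //; rewrite invr_ge0 margK_ge0.
Qed.

Lemma reply_ge0 (R : realType) (K J : finType) (C D : countType)
    (u : info_struct R K C D) (t : D -> mixed R J) (k : K) (j : J) :
  0 <= induced (condD u k) t j.
Proof. exact: induced_ge0 (condD_sum u k).1. Qed.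

Lemma reply_sum (R : realType) (K J : finType) (C D : countType)
    (u : info_struct R K C D) (t : D -> mixed R J) (k : K) :
  \sum_j induced (condD u k) t j = (margK u k)^-1 * margK u k.
Proof. by have [sD eD] := condD_sum u k; rewrite induced_sum. Qed.

Lemma conditional_mass_le1 (R : realType) (K : finType) (C D : countType)
    (u : info_struct R K C D) (k : K) : (margK u k)^-1 * margK u k <= 1.
Proof.
case: (eqVneq (margK u k) 0) => [->|h].
  by rewrite mulr0.
by rewrite mulVf.
Qed.

(** The marginal on states is itself determined by the marginal on states and
    signals of player 2, so equality of the latter suffices. *)
Lemma condD_eq (R : realType) (K : finType) (C D : countType)
    (u v : info_struct R K C D) :
  (forall k d, margKD u k d = margKD v k d) -> condD u = condD v.
Proof.
move=> huv; apply/funext => k; apply/funext => d; rewrite /condD huv.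
rewrite -(margKD_sum u k).2 -(margKD_sum v k).2.
by have -> : margKD u k = margKD v k by apply/funext => d'; apply: huv.
Qed.

(** In a state of probability 0 both sides vanish, so this form of conditional
    independence holds in every state. *)
Lemma cond_indep_factor (R : realType) (K : finType) (C D : countType)
    (u : info_struct R K C D) (k : K) (c : C) (d : D) :
  cond_indep u -> u k c d = margKC u k c * condD u k d.
Proof.
move=> hu; rewrite /condD; case: (eqVneq (margK u k) 0) => [k0|kn].
  rewrite k0 invr0 mul0r mulr0; apply/le_anti; rewrite info_ge0 andbT -k0.
  exact: (wsum_ge_term (c, d) (state_summable u k).1).
have kp : 0 < margK u k by rewrite lt_neqAle eq_sym kn margK_ge0.
by rewrite -[LHS](divfK kn) (hu k kp); field.
Qed.

Section Reduction.
Variables (R : realType) (K : finType) (C D : countType) (I J : finType).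
Implicit Types (u v : info_struct R K C D) (g : K -> I -> J -> R).
Implicit Types (s : C -> mixed R I) (t : D -> mixed R J).

Lemma expected_payoff_factor u g s t : cond_indep u ->
  expected_payoff u g s t =
  \sum_k \sum_i \sum_j
    g k i j * (induced (margKC u k) s i * induced (condD u k) t j).
Proof.
move=> hu; do 3!apply: eq_bigr => ? _; congr (_ * _).
rewrite -wsum_prod; last 2 first.
- exact: induced_summable (margKC_sum u _).1.
- exact: induced_summable (condD_sum u _).1.
rewrite /outcome_prob -/(wsum _); congr wsum; apply/funext => x.
by rewrite (cond_indep_factor _ _ _ hu) mulrACA !mulrA.
Qed.

(** The terms are grouped by pairs (k, j), the index set of player 2's array, on which [bilinear_minimax] is applied. *)
Lemma expected_payoff_bilinear u g s t : cond_indep u ->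
  expected_payoff u g s t =
  \sum_(l : K * J) (\sum_i g l.1 i l.2 * induced (margKC u l.1) s i)
                   * induced (condD u l.1) t l.2.
Proof.
move=> hu; rewrite expected_payoff_factor //.
rewrite -(pair_bigA _ (fun k j => (\sum_i g k i j * induced (margKC u k) s i)
  * induced (condD u k) t j)) /=.
apply: eq_bigr => k _; rewrite exchange_big /=; apply: eq_bigr => j _.
by rewrite mulr_suml; apply: eq_bigr => i _; rewrite mulrA.
Qed.

Lemma slope_bound u g s (l : K * J) : payoff_fun g ->
  `|\sum_i g l.1 i l.2 * induced (margKC u l.1) s i| <= 1.
Proof.
move=> [_ _ g1]; have [sC eC] := margKC_sum u l.1.
apply: le_trans (state_summable u l.1).2; rewrite -eC -(induced_sum s sC).
apply: le_trans (ler_norm_sum _ _ _) _; apply: ler_sum => i _.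
rewrite normrM (ger0_norm (induced_ge0 _ _ sC)).
by rewrite ler_piMl ?induced_ge0 // ler_norml.
Qed.

Lemma expected_payoff_bound u g s t : cond_indep u -> payoff_fun g ->
  `|expected_payoff u g s t| <= #|K|%:R.
Proof.
move=> hu g1; rewrite expected_payoff_bilinear //.
apply: le_trans (ler_norm_sum _ _ _) _.
apply: le_trans (_ : \sum_(l : K * J) induced (condD u l.1) t l.2 <= _).
  apply: ler_sum => l _; rewrite normrM.
  rewrite [X in _ * X]ger0_norm ?reply_ge0 //.
  by apply: ler_piMl; [exact: reply_ge0|exact: slope_bound].
rewrite -(pair_bigA _ (fun k j => induced (condD u k) t j)) /=.
rewrite -sum1_card natr_sum; apply: ler_sum => k _.
by rewrite reply_sum conditional_mass_le1.
Qed.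

Lemma maxmin_eq_minmax u g : cond_indep u -> payoff_fun g ->
  maxmin u g = minmax u g.
Proof.
move=> hu g1; have [/card_gt0P[i0 _] /card_gt0P[j0 _] _] := g1.
pose a s (l : K * J) := \sum_i g l.1 i l.2 * induced (margKC u l.1) s i.
pose b t (l : K * J) := induced (condD u l.1) t l.2.
have E s t : expected_payoff u g s t = \sum_l a s l * b t l.
  exact: expected_payoff_bilinear.
rewrite /maxmin /minmax.
have -> : expected_payoff u g = fun s t => \sum_l a s l * b t l.
  by apply/funext => s; apply/funext => t.
apply: (@bilinear_minimax R _ _ _ a b 1 (fun=> pure R i0) (fun=> pure R j0)).
- by move=> s l; apply: slope_bound.
- move=> t [k j]; rewrite /b /= reply_ge0 /=.
  apply: le_trans (conditional_mass_le1 u k); rewrite -(reply_sum u t k).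
  rewrite (bigD1 j) //= lerDl; apply: sumr_ge0 => j' _.
  exact: reply_ge0.
- move=> Q p s; exists (fun c => mixture p (s ^~ c)) => l; rewrite /a.
  under [RHS]eq_bigr do rewrite mulr_sumr.
  rewrite exchange_big /=; apply: eq_bigr => i _.
  rewrite induced_mixture ?mulr_sumr; last exact: (margKC_sum _ _).1.
  by apply: eq_bigr => q _; rewrite mulrCA.
- move=> Q p t; exists (fun d => mixture p (t ^~ d)) => l; rewrite /b.
  by apply: induced_mixture; apply: (condD_sum _ _).1.
Qed.

Lemma game_value_minmax u g : cond_indep u -> payoff_fun g ->
  game_value u g = minmax u g.
Proof.
move=> hu g1; suff [_ ->] : is_value u g (game_value u g) by [].
by apply: xgetPex; exists (minmax u g); split=> //; apply: maxmin_eq_minmax.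
Qed.

End Reduction.

(** * Reduction to single-agent problems *)

Definition best_reply_payoff (R : realType) (K : finType) (C D : countType)
    (I J : finType) (u : info_struct R K C D) (g : K -> I -> J -> R)
    (t : D -> mixed R J) : R :=
  sup (range (fun s => expected_payoff u g s t)).

(** The problem that player 1 faces when player 2's strategy t is announced;
    player 2 is left with a single action. *)
Definition freeze_reply (R : realType) (K : finType) (C D : countType)
    (I J : finType) (u : info_struct R K C D) (g : K -> I -> J -> R)
    (t : D -> mixed R J) : K -> I -> unit -> R :=
  fun k i _ => \sum_j g k i j * induced (condD u k) t j.

Section Distance.
Variables (R : realType) (K : finType) (C D : countType).
Implicit Types (u v : info_struct R K C D).

Lemma best_reply_bounds (I J : finType) u (g : K -> I -> J -> R) t :
  cond_indep u -> payoff_fun g ->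
  - #|K|%:R <= best_reply_payoff u g t <= #|K|%:R.
Proof.
move=> hu g1; have [/card_gt0P[i0 _] _ _] := g1.
have hb s := expected_payoff_bound s t hu g1.
have E0 : range (fun s => expected_payoff u g s t) !=set0.
  by exists (expected_payoff u g (fun=> pure R i0) t), (fun=> pure R i0).
apply/andP; split.
  have := hb (fun=> pure R i0); rewrite ler_norml => /andP[h _].
  apply: (le_trans h); apply: ub_le_sup; last by exists (fun=> pure R i0).
  by exists #|K|%:R => _ [s _ <-]; apply: le_trans (ler_norm _) (hb s).
by apply: ge_sup => // _ [s _ <-]; apply: le_trans (ler_norm _) (hb s).
Qed.

Lemma game_value_le_best_reply (I J : finType) u (g : K -> I -> J -> R) t :
  cond_indep u -> payoff_fun g -> game_value u g <= best_reply_payoff u g t.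
Proof.
move=> hu g1; rewrite game_value_minmax //; apply: ge_inf; last by exists t.
by exists (- #|K|%:R) => _ [t' _ <-]; have /andP[] := best_reply_bounds t' hu g1.
Qed.

Lemma near_optimal_reply (I J : finType) u (g : K -> I -> J -> R) (e : R) :
  cond_indep u -> payoff_fun g -> 0 < e ->
  exists t, best_reply_payoff u g t < game_value u g + e.
Proof.
move=> hu g1 e0; have [_ /card_gt0P[j0 _] _] := g1.
have [|_ [t _ <-] ht] :=
    @inf_adherent R (range (best_reply_payoff u g)) e e0; last first.
  by exists t; rewrite game_value_minmax.
split; first by exists (best_reply_payoff u g (fun=> pure R j0)), (fun=> pure R j0).
by exists (- #|K|%:R) => _ [t' _ <-]; have /andP[] := best_reply_bounds t' hu g1.
Qed.

Lemma game_value_bound (I J : finType) u (g : K -> I -> J -> R) :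
  cond_indep u -> payoff_fun g -> `|game_value u g| <= #|K|%:R.
Proof.
move=> hu g1; have [_ /card_gt0P[j0 _] _] := g1.
have hb t := best_reply_bounds t hu g1.
rewrite ler_norml; apply/andP; split; last first.
  apply: le_trans (game_value_le_best_reply (fun=> pure R j0) hu g1) _.
  by have /andP[] := hb (fun=> pure R j0).
rewrite game_value_minmax //; apply: lb_le_inf.
  by exists (best_reply_payoff u g (fun=> pure R j0)), (fun=> pure R j0).
by move=> _ [t _ <-]; have /andP[] := hb t.
Qed.

Lemma freeze_reply_payoff (I J : finType) u (g : K -> I -> J -> R) t :
  payoff_fun g -> payoff_fun (freeze_reply u g t).
Proof.
move=> [I0 _ g1]; split=> // [|k i j0]; first by rewrite card_unit.
rewrite -ler_norml; apply: le_trans (ler_norm_sum _ _ _) _.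
apply: le_trans (conditional_mass_le1 u k); rewrite -(reply_sum u t k).
apply: ler_sum => j _; rewrite normrM (ger0_norm (reply_ge0 _ _ _ _)).
by rewrite ler_piMl ?reply_ge0 // ler_norml.
Qed.

(** The frozen problem is built with the conditional laws of u, but these are
    also those of v; so facing it under v amounts to facing t in (v, g),
    whatever the dummy player does. *)
Lemma freeze_reply_value (I J : finType) u v (g : K -> I -> J -> R) t :
  cond_indep v -> payoff_fun g ->
  (forall k d, margKD u k d = margKD v k d) ->
  game_value v (freeze_reply u g t) = best_reply_payoff v g t.
Proof.
move=> hv g1 huv; have G1 := freeze_reply_payoff u t g1.
have same s t' : expected_payoff v (freeze_reply u g t) s t'
               = expected_payoff v g s t.
  rewrite !expected_payoff_factor // /freeze_reply (condD_eq huv).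
  apply: eq_bigr => k _; apply: eq_bigr => i _ /=; rewrite -[LHS]mulr_sumr -[X in _ * X]mulr_sumr.
  (* The dummy player's array has mass 1, or 0 in a state of probability 0,
     where player 1's array vanishes too. *)
  have -> : induced (margKC v k) s i * (\sum_(j : unit) induced (condD v k) t' j)
          = induced (margKC v k) s i.
    rewrite reply_sum; case: (eqVneq (margK v k) 0) => [k0|kn]; last first.
      by rewrite mulVf // mulr1.
    rewrite k0 mulr0 mulr0; apply/le_anti; rewrite induced_ge0 /=; last first.
      exact: (margKC_sum v k).1.
    have [sC eC] := margKC_sum v k; rewrite -k0 -eC -(induced_sum s sC).
    rewrite (bigD1 i) //= lerDl; apply: sumr_ge0 => i' _.
    exact: induced_ge0 sC.
  by rewrite mulr_suml; apply: eq_bigr => j _; rewrite mulrAC mulrA.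
rewrite game_value_minmax // /minmax.
have -> : range (fun t' => sup (range (fun s =>
    expected_payoff v (freeze_reply u g t) s t'))) = [set best_reply_payoff v g t].
  apply/seteqP; split=> [_ [t' _ <-]|_ ->] /=; last exists (fun=> pure R tt) => //.
    by rewrite /best_reply_payoff; congr sup; congr image; apply/funext => s.
  by rewrite /best_reply_payoff; congr sup; congr image; apply/funext => s.
exact: inf1.
Qed.

(** Announcing a reply t that is optimal up to e in (u, g) costs player 2 at
    most e under u, and can only favour player 1 under v. *)
Lemma single_agent_gap (I J : finType) u v (g : K -> I -> J -> R) (e : R) :
  cond_indep u -> cond_indep v ->
  (forall k d, margKD u k d = margKD v k d) -> payoff_fun g -> 0 < e ->
  exists G : K -> I -> unit -> R, [/\ payoff_fun G, single_agent G &
    game_value v g - game_value u g <= game_value v G - game_value u G + e].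
Proof.
move=> hu hv huv g1 e0; have [t ht] := near_optimal_reply hu g1 e0.
exists (freeze_reply u g t); split=> //; first exact: freeze_reply_payoff.
rewrite (freeze_reply_value t hu) // (freeze_reply_value t hv) //.
rewrite -[leRHS]addrA; apply: lerD; first exact: game_value_le_best_reply.
by rewrite lerNl opprD opprK lerBlDr ltW.
Qed.

(** The uniform bound on values makes the supremum d_1 an upper bound of its
    set; the supremum of an unbounded set would be 0. *)
Lemma vdist1_ub (I J : finType) u v (g : K -> I -> J -> R) :
  cond_indep u -> cond_indep v -> payoff_fun g -> single_agent g ->
  `|game_value u g - game_value v g| <= vdist1 u v.
Proof.
move=> hu hv g1 gs; apply: ub_le_sup; last by exists I, J, g; split.
exists (#|K|%:R + #|K|%:R) => _ [I' [J' [g' [g1' _ ->]]]].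
by apply: le_trans (ler_normB _ _) _; apply: lerD; apply: game_value_bound.
Qed.

Lemma vdist_ub (I J : finType) u v (g : K -> I -> J -> R) :
  cond_indep u -> cond_indep v ->
  (forall k d, margKD u k d = margKD v k d) -> payoff_fun g ->
  `|game_value u g - game_value v g| <= vdist1 u v.
Proof.
move=> hu hv huv g1; apply/ler_addgt0Pr => e e0.
have hvu k d : margKD v k d = margKD u k d by rewrite huv.
have [G [G1 Gs GE]] := single_agent_gap hu hv huv g1 e0.
have [H [H1 Hs HE]] := single_agent_gap hv hu hvu g1 e0.
rewrite ler_norml; apply/andP; split.
  rewrite lerNl opprB; apply: le_trans GE _; rewrite lerD2r.
  by apply: le_trans (ler_norm _) _; rewrite distrC; apply: vdist1_ub.
apply: le_trans HE _; rewrite lerD2r.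
by apply: le_trans (ler_norm _) _; apply: vdist1_ub.
Qed.

End Distance.

Theorem proposition2 (R : realType) (K : finType) (C D : countType)
    (u v : info_struct R K C D)
    (hK : (2 <= #|K|)%N)
    (hu : cond_indep u) (hv : cond_indep v)
    (huv : forall (k : K) (d : D), margKD u k d = margKD v k d) :
  vdist u v = vdist1 u v.
Proof.
have zero1 : payoff_fun (fun (_ : K) (_ _ : unit) => 0 : R).
  by split=> [||k i j]; rewrite ?card_unit // lerN10 ler01.
apply/eqP; rewrite eq_le; apply/andP; split.
  apply: ge_sup => [|_ [I [J [g [g1 ->]]]]]; last exact: vdist_ub.
  by eexists; exists unit, unit, (fun _ _ _ => 0); split.
apply: ge_sup => [|_ [I [J [g [g1 _ ->]]]]].
  by eexists; exists unit, unit, (fun _ _ _ => 0); split.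
apply: ub_le_sup; last by exists I, J, g.
by exists (vdist1 u v) => _ [I' [J' [g' [g1' ->]]]]; apply: vdist_ub.
Qed.
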